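(* Let $n\ge 1$ be an integer and let $a,b,c\in\mathbb{R}$ with $ac>0$. Put $s=\sqrt{ac}$ and $q=s/c$. Let $A_n=A_n(a,b,c)$, $S=A_n(s,b,s)$, $D=\operatorname{diag}(1,q,q^2,\dots,q^{n-1})$ and $W=D^{-2}$. Then $$D^{-1}A_nD=S.$$ Equivalently, $A_n$ is self-adjoint in the weighted inner product induced by $W$, in the sense that $$A_n^{T}W=WA_n.$$
   Context: For $n\ge 1$ and $a,b,c\in\mathbb{R}$, $A_n(a,b,c)$ denotes the $n\times n$ tridiagonal Toeplitz matrix with all diagonal entries equal to $b$, all subdiagonal entries (positions $(i+1,i)$) equal to $a$, all superdiagonal entries (positions $(i,i+1)$) equal to $c$, and all other entries $0$. The weighted inner product induced by $W$ is $\langle x,y\rangle_W=x^{T}Wy$ for $x,y\in\mathbb{R}^n$. *)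

(* Defs.v *)
From HB Require Import structures.
From mathcomp Require Import all_boot all_order all_algebra.
From mathcomp Require Import reals.

Set Implicit Arguments.
Unset Strict Implicit.
Unset Printing Implicit Defensive.

Import Order.TTheory GRing.Theory Num.Theory.
Local Open Scope ring_scope.

(* [a] sits on the subdiagonal and [c] on the superdiagonal. *)
Definition tridiag_toeplitz (R : realType) (n : nat) (a b c : R) : 'M[R]_n :=
  \matrix_(i < n, j < n)
    if (i == j :> nat) then b
    else if (i == j.+1 :> nat) then a
    else if (j == i.+1 :> nat) then c
    else 0.

Definition weighted_ip (R : realType) (n : nat) (W : 'M[R]_n)
    (x y : 'cV[R]_n) : R :=
  (x^T *m W *m y) 0 0.

Definition self_adjoint_wrt (R : realType) (n : nat) (W A : 'M[R]_n) : Prop :=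
  forall x y : 'cV[R]_n, weighted_ip W (A *m x) y = weighted_ip W x (A *m y).

(* Main.v *)
Require Import Defs.
From HB Require Import structures.
From mathcomp Require Import all_boot all_order all_algebra.
From mathcomp Require Import reals.

Set Implicit Arguments.
Unset Strict Implicit.
Unset Printing Implicit Defensive.

Import Order.TTheory GRing.Theory Num.Theory.
Local Open Scope ring_scope.

(** Conjugating by [D = diag(1, q, ..., q^(n-1))] multiplies the entry [(i, j)]
    of a matrix by [q ^ (j - i)].  It fixes the diagonal, divides the
    subdiagonal by [q] and multiplies the superdiagonal by [q].  With
    [q = s / c] and [s ^ 2 = a * c] both off-diagonals become [s], because
    [q * s = a] and [c * q = s]; this is the entrywise identity behind
    [toeplitz_diag_intertwine], [A D = D S].

    The conjugated matrix [S] is symmetric, so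
    [A D ^ 2 = D S D] is symmetric as well when [D] is.  Hence
    [D ^ 2 A^T = A D ^ 2], and multiplying by [W = D ^ -2] on both sides gives
    [A^T W = W A]; this is [symmetrizable_weight].  Self-adjointness for the
    form [x^T W y] then follows by moving [A^T] across [W]. *)

Lemma tr_tridiag_toeplitz (R : realType) n (a b c : R) :
  (tridiag_toeplitz n a b c)^T = tridiag_toeplitz n c b a.
Proof.
apply/matrixP => i j; rewrite !mxE [(j : nat) == i]eq_sym.
case: eqP => // _; case: (eqVneq (j : nat) i.+1) => [ji|//].
(* [j = i + 1] excludes [i = j + 1], so the order of the tests does not matter *)
by rewrite ji ltn_eqF // ltnS leqnSn.
Qed.

(** Entrywise the claim reads [A i j * q ^ j = q ^ i * S i j].  After cancelling
    the common power of [q], the subdiagonal [i = j + 1] is the first hypothesis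
    and the superdiagonal [j = i + 1] the second. *)
Lemma toeplitz_diag_intertwine (R : realType) n (a b c s q : R) :
  q * s = a -> c * q = s ->
  let D : 'M[R]_n := diag_mx (\row_(i < n) q ^+ i) in
  tridiag_toeplitz n a b c *m D = D *m tridiag_toeplitz n s b s.
Proof.
move=> qs cq /=; rewrite mul_mx_diag mul_diag_mx; apply/matrixP => i j.
rewrite !mxE; case: eqP => [->|_]; first by rewrite mulrC.
case: eqP => [->|_]; first by rewrite -qs exprSr mulrC mulrA.
case: eqP => [->|_]; last by rewrite mulr0 mul0r.
by rewrite exprS mulrA cq mulrC.
Qed.

(** With all inverses cleared the claim is [D ^ 2 A^T = A D ^ 2], which holds
    because [A D ^ 2 = D S D] is symmetric. *)
Lemma symmetrizable_weight (R : comUnitRingType) n (A D S : 'M[R]_n) :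
  D \in unitmx -> D^T = D -> S^T = S -> A *m D = D *m S ->
  A^T *m invmx (D ^+ 2) = invmx (D ^+ 2) *m A.
Proof.
move=> uD symD symS AD; rewrite expr2 -[D * D]/(D *m D).
have uDD : D *m D \in unitmx by rewrite unitmx_mul uD.
have ADD : A *m (D *m D) = D *m S *m D by rewrite mulmxA AD.
have comm : (D *m D) *m A^T = A *m (D *m D).
  have : (A *m (D *m D))^T = A *m (D *m D).
    by rewrite ADD !trmx_mul symD symS mulmxA.
  by rewrite {1}trmx_mul trmx_mul symD.
move: (D *m D) uDD comm => E uE comm.
by rewrite -[A^T](mulKmx uE) comm -!mulmxA (mulmxV uE) mulmx1.
Qed.

Lemma self_adjoint_of_intertwine (R : realType) n (W A : 'M[R]_n) :
  A^T *m W = W *m A -> self_adjoint_wrt W A.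
Proof.
move=> AW x y; rewrite /weighted_ip trmx_mul -(mulmxA x^T A^T) AW.
by rewrite !mulmxA.
Qed.

Theorem lemma2p2 (R : realType) (n : nat) (hn : (1 <= n)%N) (a b c : R)
    (hac : 0 < a * c) :
  let s := Num.sqrt (a * c) in
  let q := s / c in
  let A := tridiag_toeplitz n a b c in
  let S := tridiag_toeplitz n s b s in
  let D : 'M[R]_n := diag_mx (\row_(i < n) q ^+ i) in
  let W := invmx (D ^+ 2) in
  [/\ D \in unitmx,
      invmx D *m A *m D = S,
      A^T *m W = W *m A
    & self_adjoint_wrt W A].
Proof.
move=> s q A S D W.
have c_neq0 : c != 0 by apply: contraTneq hac => ->; rewrite mulr0 ltxx.
have s_neq0 : s != 0 by rewrite gt_eqF // sqrtr_gt0.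
have q_neq0 : q != 0 by rewrite mulf_neq0 ?invr_eq0.
have qs : q * s = a.
  by rewrite /q mulrAC -expr2 sqr_sqrtr ?(ltW hac) // mulfK.
have cq : c * q = s by rewrite /q mulrC divfK.
have AD : A *m D = D *m S := toeplitz_diag_intertwine n b qs cq.
have uD : D \in unitmx.
  rewrite unitmxE det_diag unitfE; apply/prodf_neq0 => i _.
  by rewrite mxE expf_neq0.
have AW : A^T *m W = W *m A.
  by apply: symmetrizable_weight AD; rewrite ?tr_diag_mx ?tr_tridiag_toeplitz.
split=> //; last exact: self_adjoint_of_intertwine.
by rewrite -mulmxA AD mulKmx.
Qed.
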